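(* Let $F$ be a polybox in a $d$-box $X$, let $\mathcal{F}$ and $\mathcal{G}$ be two proper suits for $F$, and let $f$ be an additive real-valued function on the proper boxes of $X$. Then $\sum_{A\in\mathcal{F}}f(A)=\sum_{A\in\mathcal{G}}f(A)$.
   Context: A $d$-box is $X=X_1\times\cdots\times X_d$ with finite nonempty sets $X_i$. A box is a nonempty $A_1\times\cdots\times A_d$ with $A_i\subseteq X_i$, proper if $A_i\neq X_i$ for all $i$. Boxes $A,B$ are dichotomous if $A_i=X_i\setminus B_i$ for some $i$; a suit is a family of pairwise dichotomous boxes, proper if all its boxes are proper, a suit for $F$ if its union is $F$; a polybox is a nonempty set having a suit. Two boxes $A,B$ form a twin pair if for some $i$, $A_j=B_j$ for all $j\neq i$ and $A_i=X_i\setminus B_i$. A function $f$ on proper boxes is additive if for any two twin pairs $A,B$ and $C,D$ of proper boxes with $A\cup B=C\cup D$, $f(A)+f(B)=f(C)+f(D)$. *)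

(* Defs.v *)
From mathcomp Require Import all_boot all_order all_algebra.
From mathcomp Require Import reals.

Set Implicit Arguments.
Unset Strict Implicit.
Unset Printing Implicit Defensive.

Import GRing.Theory Num.Theory.
Local Open Scope ring_scope.

Section Boxes.
Variables (d : nat) (X : 'I_d -> finType).

Definition point := {dffun forall i : 'I_d, X i}.

Implicit Types (A B C D F : {set point}) (FF : {set {set point}}).
Implicit Types (a b : forall i : 'I_d, {set X i}).

(* A nonempty product determines its factors, so for every A there is at most
   one a, up to pointwise equality, with [box_with A a]. *)
Definition box_with A a : Prop := A = setXn a /\ A != set0.

Definition box A : Prop := exists a, box_with A a.

Definition proper_box A : Prop :=
  exists a, box_with A a /\ forall i, a i <> [set: X i].

Definition dichotomous A B : Prop :=
  exists a b, [/\ box_with A a, box_with B b & exists i, a i = ~: b i].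

Definition twin_pair A B : Prop :=
  exists a b, [/\ box_with A a, box_with B b &
    exists i, a i = ~: b i /\ forall j, j != i -> a j = b j].

Definition suit FF : Prop :=
  (forall A, A \in FF -> box A) /\
  (forall A B, A \in FF -> B \in FF -> A <> B -> dichotomous A B).

Definition proper_suit FF : Prop :=
  suit FF /\ forall A, A \in FF -> proper_box A.

Definition suit_for FF F : Prop := suit FF /\ cover FF = F.

Definition polybox F : Prop := F != set0 /\ exists FF, suit_for FF F.

(* A function on proper boxes is encoded as a function on all sets of points;
   its values elsewhere are unconstrained. *)
Definition box_additive (R : realType) (f : {set point} -> R) : Prop :=
  forall A B C D,
    proper_box A -> proper_box B -> proper_box C -> proper_box D ->
    twin_pair A B -> twin_pair C D -> A :|: B = C :|: D ->
    f A + f B = f C + f D.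

End Boxes.

(* Main.v *)
(** For a subset [A] of [X_i] and an odd set [E], let [odd_meet E A] be the parity
of [#|E :&: A|]. If every [E i] is odd, complementary sides have opposite
parities, so at most one box of a suit meets the product of the [E i] in an odd
number of points. Hence the sum over a suit of the products of the
[odd_meet (E i) (A_i)] is the parity of the number of points of that product in
the union of the suit, and depends on the union only. Since characters are
orthogonal, every function of one nontrivial set whose values at a set and its
complement have constant sum is a linear combination of the [odd_meet E].
Applied to one coordinate after the other, this writes an additive function of
proper boxes as a combination of such products. *)

Require Import Defs.
From mathcomp Require Import all_boot all_order all_algebra.
From mathcomp Require Import reals ring lra.
Import GRing.Theory Num.Theory.
Local Open Scope ring_scope.
Set Implicit Arguments. Unset Strict Implicit.
Unset Printing Implicit Defensive.

(** * Parity characters on the subsets of one finite set *)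

Section Coordinate.
Variables (R : realFieldType) (T : finType).
Implicit Types A B E : {set T}.

Definition nontrivial A := (A != set0) && (A != setT).

(** These are the characters of the group of subsets of [T] under symmetric difference. *)
Definition chi B E : R := (-1) ^+ #|E :&: B|.

(** The factor [odd #|E|] kills the even sets, so sums may run over all [E]. *)
Definition odd_meet E A : R := (odd #|E| && odd #|E :&: A|)%:R.

Lemma nontrivialC A : nontrivial (~: A) = nontrivial A.
Proof. by rewrite /nontrivial -{1}setCT -{2}setC0 !(inj_eq (@setC_inj T)) andbC. Qed.

Lemma chi0 E : chi set0 E = 1.
Proof. by rewrite /chi setI0 cards0. Qed.

Lemma chiM A B E : chi A E * chi B E = chi ((A :\: B) :|: (B :\: A)) E.
Proof.
rewrite /chi -exprD -[LHS]signr_odd -[RHS]signr_odd; congr (_ ^+ nat_of_bool _).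
have H (C D : {set T}) :
    #|E :&: C| = (#|E :&: (C :&: D)| + #|E :&: (C :\: D)|)%N.
  by rewrite -(cardsID D (E :&: C)) setIA setIDA.
rewrite (H A B) (H B A) setIUr cardsU (setIC B A).
rewrite (_ : _ :&: (E :&: (B :\: A)) = set0); last first.
  by apply/setP => x; rewrite !inE; case: (x \in A); case: (x \in B); rewrite ?andbF.
rewrite cards0 subn0 !oddD.
by case: (odd _); case: (odd _); case: (odd _).
Qed.

Lemma sum_chi B : \sum_E chi B E = (2 ^ #|T| * (B == set0))%:R.
Proof.
have [-> | [x xB]] := set_0Vmem B.
  rewrite eqxx muln1 (eq_bigr (fun=> 1)) => [|E _]; last exact: chi0.
  rewrite sumr_const; congr (_ *+ _).
  by rewrite -(cardsT T) -card_powerset powersetT cardsT.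
have -> : (B == set0) = false by apply/negbTE/set0Pn; exists x.
rewrite muln0.
(* Toggling the point [x] of [B] in [E] changes the parity of [E :&: B], so the terms cancel in
   pairs. *)
pose flip E := (E :\: [set x]) :|: ([set x] :\: E).
have flipK : involutive flip.
  by move=> E; apply/setP => y; rewrite !inE; case: eqP; case: (y \in E).
have chiC A E : chi A E = chi E A by rewrite /chi setIC.
have E : \sum_E chi B E = - \sum_E chi B E.
  rewrite {1}(reindex_inj (inv_inj flipK)) -sumrN; apply: eq_bigr => E _.
  rewrite chiC -chiM chiC /chi (_ : B :&: [set x] = [set x]) ?cards1 ?mulrN1 //.
  by apply/setIidPr; rewrite sub1set.
lra.
Qed.

(** The condition says that [E :&: A] is odd and [E :\: A] is even. With u and v the values at [E]
    of the characters of [A] and [~: A], its indicator is (1 - u)(1 + v) / 4, and uv is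
    [chi setT E]. *)
Lemma odd_meetE E A :
  odd_meet E A = (1 - chi setT E - chi A E + chi (~: A) E) / 4.
Proof.
rewrite /odd_meet /chi setIT -(cardsID A E) -setDE -[X in _ + X]signr_odd.
rewrite -[X in _ - X + _]signr_odd -[X in _ - X - _]signr_odd oddD.
by case: (odd _); case: (odd _) => /=; rewrite ?expr0 ?expr1; field.
Qed.

Lemma sum_chi_mul A B : \sum_E chi A E * chi B E = (2 ^ #|T| * (A == B))%:R.
Proof.
under eq_bigr do rewrite chiM.
by rewrite sum_chi setU_eq0 !setD_eq0 -eqEsubset.
Qed.

Lemma sum_chi_odd_meet B A :
  \sum_E chi B E * odd_meet E A =
  2 ^+ #|T| / 4 *
    ((B == set0)%:R - (B == setT)%:R - (B == A)%:R + (B == ~: A)%:R).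
Proof.
transitivity (4^-1 * (\sum_E chi B E * chi set0 E - \sum_E chi B E * chi setT E
    - \sum_E chi B E * chi A E + \sum_E chi B E * chi (~: A) E)).
  rewrite -!sumrB -big_split /= big_distrr; apply: eq_bigr => E _ /=.
  rewrite odd_meetE chi0; ring.
rewrite !sum_chi_mul !natrM !natrX; ring.
Qed.

(* The characters [chi B], with [B] taken up to complement, are orthogonal over
   the odd sets [E]; the coefficients below come from inverting the relation
   [odd_meet E A = (1 - chi A E) / 2] there. *)
Definition kernel B E : R :=
  (4 / #|[pred C | nontrivial C]|%:R - 2 * chi B E) / 2 ^+ #|T|.

Lemma sum_kernel B A : nontrivial A -> nontrivial B ->
  \sum_E kernel B E * odd_meet E A =
  #|[pred C | nontrivial C]|%:R^-1 + ((B == A)%:R - (B == ~: A)%:R) / 2.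
Proof.
move=> ntA /andP[B0 BT]; case/andP: (ntA) => A0 AT; set P := #|_|%:R.
have P0 : P != 0 by rewrite pnatr_eq0 -lt0n; apply/card_gt0P; exists A.
have n0 : 2 ^+ #|T| != 0 :> R by rewrite expf_neq0 ?pnatr_eq0.
transitivity ((4 / P * \sum_E chi set0 E * odd_meet E A
   - 2 * \sum_E chi B E * odd_meet E A) / 2 ^+ #|T|).
  rewrite !big_distrr -sumrB mulr_suml /=; apply: eq_bigr => E _.
  rewrite /kernel chi0 -/P; ring.
rewrite !sum_chi_odd_meet eqxx (negbTE B0) (negbTE BT).
have -> : (set0 == setT :> {set T}) = false.
  by apply: contraNF A0 => /eqP e; rewrite -subset0 e subsetT.
have -> : (set0 == ~: A) = false.
  by apply: contraNF AT => /eqP e; rewrite -(setCK A) -e setC0.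
rewrite eq_sym (negbTE A0) /=; field.
by rewrite P0 n0.
Qed.

(** By [sum_kernel] the right side is the mean of [g] over the nontrivial sets plus half of
    [g A - g (~: A)]. Pairing complements shows that this mean is half of [g A + g (~: A)]. *)
Lemma kernel_interpolation (g : {set T} -> R) A :
  nontrivial A ->
  (forall B, nontrivial B -> g B + g (~: B) = g A + g (~: A)) ->
  g A = \sum_(B | nontrivial B) \sum_E kernel B E * odd_meet E A * g B.
Proof.
move=> ntA gC; have ntCA : nontrivial (~: A) by rewrite nontrivialC.
set P := #|[pred C | nontrivial C]|.
have P0 : P%:R != 0 :> R by rewrite pnatr_eq0 -lt0n; apply/card_gt0P; exists A.
have G : (\sum_(B | nontrivial B) g B) * 2 = (g A + g (~: A)) * P%:R.
  rewrite mulr_natr mulr2n {2}(reindex_inj (@setC_inj T)) /=.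
  rewrite (eq_bigl nontrivial _ nontrivialC) -big_split /=.
  by rewrite (eq_bigr _ gC) sumr_const mulr_natr.
transitivity (P%:R^-1 * \sum_(B | nontrivial B) g B
    + (\sum_(B | nontrivial B) (B == A)%:R * g B
       - \sum_(B | nontrivial B) (B == ~: A)%:R * g B) / 2).
  have delta C : nontrivial C ->
      \sum_(B | nontrivial B) (B == C)%:R * g B = g C.
    move=> ntC; rewrite (bigD1 C) //= eqxx mul1r big1 ?addr0 // => B.
    by case/andP=> _ /negbTE->; rewrite mul0r.
  rewrite !delta //; apply: (mulIf (_ : 2 != 0)); first by rewrite pnatr_eq0.
  rewrite mulrDl -mulrA G; field.
  by rewrite P0.
rewrite -sumrB mulr_suml big_distrr -big_split /=; apply: eq_bigr => B ntB.
rewrite -mulr_suml sum_kernel // -/P; ring.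
Qed.

End Coordinate.

(** * Interpolation one coordinate at a time *)

Section Tuples.
Variables (R : realFieldType) (d : nat) (X : 'I_d -> finType).
Implicit Types (a b E : forall i, {set X i}).

Definition additive_from (k : nat) (g : (forall i, {set X i}) -> R) :=
  forall a (i : 'I_d) (B C : {set X i}), (k <= i)%N ->
    (forall j, nontrivial (a j)) -> nontrivial B -> nontrivial C ->
    g (dfwith a B) + g (dfwith a (~: B)) = g (dfwith a C) + g (dfwith a (~: C)).

(** Together with [additive_from], this is the state of the induction: the coordinates below [k]
    have been traded for parity factors, and [g] no longer sees them. *)
Definition depends_from (k : nat) (g : (forall i, {set X i}) -> R) :=
  forall a b, (forall i : 'I_d, (k <= i)%N -> a i = b i) -> g a = g b.

(* Induction on [d - k]: interpolation trades coordinate [k] of [g] for one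
   more factor [odd_meet]. *)
Lemma eq_sum_additive_from (I : finType) (P Q : {set I})
    (s : I -> forall i, {set X i}) :
  (forall A, A \in P :|: Q -> forall i, nontrivial (s A i)) ->
  (forall E, \sum_(A in P) \prod_i odd_meet R (E i) (s A i) =
             \sum_(A in Q) \prod_i odd_meet R (E i) (s A i)) ->
  forall k g E, (k <= d)%N -> depends_from k g -> additive_from k g ->
  \sum_(A in P) (\prod_(i < d | (i < k)%N) odd_meet R (E i) (s A i)) * g (s A) =
  \sum_(A in Q) (\prod_(i < d | (i < k)%N) odd_meet R (E i) (s A i)) * g (s A).
Proof.
move=> nts PQ k g E; move: {2}(d - k)%N (leqnn (d - k)) => n.
elim: n k g E => [|n IH] k g E dk kd gk gA.
  have ek : k = d by apply/eqP; rewrite eqn_leq kd -subn_eq0 -leqn0.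
  (* No coordinate is left, so [g] is constant; the tuple of empty sets is an arbitrary reference
     point. *)
  have gc a : g a = g (fun i => set0).
    by apply: gk => i; rewrite ek leqNgt ltn_ord.
  under eq_bigr => A _ do (rewrite gc; under eq_bigl => i do rewrite ek ltn_ord).
  under [RHS]eq_bigr => A _ do
    (rewrite gc; under eq_bigl => i do rewrite ek ltn_ord).
  by rewrite -!mulr_suml PQ.
have [|ltkd] := leqP d k.
  by rewrite -subn_eq0 => /eqP e; apply: IH; rewrite // e.
pose j := Ordinal ltkd.
(* The coefficients do not depend on [S], so expanding the sums over [P] and over [Q] leaves a
   termwise comparison. Coordinate [j] of [g] is frozen at [B], and [D] fills slot [j] of [E]. *)
have step (S : {set I}) : S \subset P :|: Q ->
  \sum_(A in S) (\prod_(i < d | (i < k)%N) odd_meet R (E i) (s A i)) * g (s A) =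
  \sum_(B : {set X j} | nontrivial B) \sum_(D : {set X j}) kernel R B D *
  \sum_(A in S) (\prod_(i < d | (i < k.+1)%N) odd_meet R (dfwith E D i) (s A i))
     * g (dfwith (s A) B).
  move=> /subsetP SPQ.
  under [RHS]eq_bigr => B _ do under eq_bigr => D _ do rewrite big_distrr.
  under [RHS]eq_bigr => B _ do rewrite exchange_big.
  rewrite exchange_big /=; apply: eq_bigr => A /SPQ /nts ntA.
  have -> : g (s A) = g (dfwith (s A) (s A j)).
    by apply: gk => i _; case: dfwithP.
  rewrite (kernel_interpolation (g := fun B => g (dfwith (s A) B)) (ntA j)).
    rewrite big_distrr; apply: eq_bigr => B _ /=.
    rewrite big_distrr; apply: eq_bigr => D _ /=.
    rewrite [in RHS](bigD1 j) ?ltnS ?leqnn //= dfwith_in.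
    rewrite [in RHS](eq_big (fun i : 'I_d => (i < k)%N)
      (fun i => odd_meet R (E i) (s A i))).
    - by ring.
    - by move=> i; rewrite ltnS ltn_neqAle andbC -(inj_eq val_inj).
    - by move=> i /andP[_ ij]; rewrite dfwith_out // eq_sym.
  by move=> B ntB; apply: gA => //; exact: ntA.
rewrite !step ?subsetUl ?subsetUr //.
apply: eq_bigr => B ntB; apply: eq_bigr => D _; congr (_ * _).
apply: (IH k.+1 (fun a => g (dfwith a B)) (dfwith E D) _ ltkd).
- by rewrite subnS; case: (d - k)%N dk.
- move=> a b ab; apply: gk => i ki; case: (eqVneq j i) => [<-|ji].
    by rewrite !dfwith_in.
  rewrite !dfwith_out // ab // ltn_neqAle ki andbT.
  by rewrite -(inj_eq val_inj) in ji.
- move=> a i C C' ki nta ntC ntC'.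
  have ji : j != i by rewrite -(inj_eq val_inj) neq_ltn ki.
  (* Changes at the distinct coordinates [i] and [j] commute. *)
  have swap (C0 : {set X i}) :
      g (dfwith (dfwith a C0) B) = g (dfwith (dfwith a B) C0).
    apply: gk => l _; case: (eqVneq j l) => [<-|jl].
      by rewrite dfwith_in dfwith_out 1?eq_sym // dfwith_in.
    rewrite dfwith_out //; case: (eqVneq i l) => [<-|il].
      by rewrite !dfwith_in.
    by rewrite !dfwith_out.
  rewrite !swap; apply: gA => //; first exact: ltnW.
  by move=> l; case: dfwithP.
Qed.

End Tuples.

(** * Parity counts on suits *)

Section Suits.
Variables (R : realFieldType) (d : nat) (X : 'I_d -> finType).
Implicit Types (a b E : forall i, {set X i}) (A B : {set point X}).

(** Projection gives a canonical choice of the factors that [box_with] only asserts to exist. *)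
Definition side A (i : 'I_d) : {set X i} := [set p i | p : point X in A].

Lemma side_setXn a i : setXn a != set0 -> side (setXn a) i = a i.
Proof.
case/set0Pn => p /setXnP pa; apply/setP => x; apply/imsetP/idP => [[q]|xa].
  by move=> /setXnP qa ->.
(* Moving coordinate [i] of a point [p] of the product to [x] stays inside the product. *)
exists [ffun j => dfwith (fun j => p j) x j : X j]; last first.
  by rewrite ffunE dfwith_in.
by apply/setXnP => j; rewrite ffunE; case: dfwithP.
Qed.

Lemma box_withE A a : box_with A a -> forall i, side A i = a i.
Proof. by case=> -> A0 i; exact: side_setXn. Qed.

Lemma setXn_side A : box A -> setXn (side A) = A.
Proof.
by case=> a Aa; rewrite (eq_setXn (box_withE Aa)); case: Aa.
Qed.

Lemma proper_box_side A i : proper_box A -> nontrivial (side A i).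
Proof.
case=> a [Aa aT]; rewrite (box_withE Aa) /nontrivial; case: Aa => -> .
case/set0Pn => p /setXnP pa; apply/andP; split; last exact/eqP/aT.
by apply/set0Pn; exists (p i).
Qed.

Lemma setXn_neq0 a : (forall i, a i != set0) -> setXn a != set0.
Proof.
by move=> a0; rewrite -card_gt0 cardsXn prodn_gt0 // => i; rewrite card_gt0.
Qed.

Lemma dichotomous_side A B : dichotomous A B -> exists i, side A i = ~: side B i.
Proof.
case=> a [b [Aa Bb [i ab]]]; exists i.
by rewrite (box_withE Aa) (box_withE Bb).
Qed.

Lemma trivIset_suit (FF : {set {set point X}}) : suit FF -> trivIset FF.
Proof.
case=> FFbox FFdich; apply/trivIsetP => A B AF BF /eqP AB.
have [i eqi] := dichotomous_side (FFdich _ _ AF BF AB).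
rewrite -setI_eq0 -(setXn_side (FFbox _ AF)) -(setXn_side (FFbox _ BF)).
apply/eqP/setP => p; rewrite in_setI in_set0; apply/negbTE/negP => /andP[].
move=> /setXnP pA /setXnP pB; have := pA i.
by rewrite eqi inE pB.
Qed.

Lemma prod_odd (I : finType) (n : I -> nat) :
  odd (\prod_i n i) = [forall i, odd (n i)].
Proof. by rewrite (big_morph odd oddM (erefl _)) big_andE. Qed.

(** A product of integers is odd iff all factors are, and the sizes of the [E i :&: side A i]
    multiply to that of [setXn E :&: A]. *)
Lemma prod_odd_meet E A : box A ->
  \prod_i odd_meet R (E i) (side A i) =
  ([forall i, odd #|E i|] && odd #|setXn E :&: A|)%:R.
Proof.
move=> Abox; rewrite -{2}(setXn_side Abox).
have -> : setXn E :&: setXn (side A) = setXn (fun i => E i :&: side A i).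
  apply/setP => p; rewrite (in_setI, in_setU); apply/andP/setXnP => [[] |H].
    by move=> /setXnP pE /setXnP pA i; rewrite inE pE pA.
  by split; apply/setXnP => i; have:= H i; rewrite inE => /andP[].
rewrite cardsXn prod_odd /odd_meet -natr_prod; congr _%:R.
have nat_andM : {morph nat_of_bool : x y / x && y >-> (x * y)%N}.
  by move=> x y; rewrite mulnb.
rewrite -(big_morph _ nat_andM (erefl : true = 1%N :> nat)).
by rewrite big_split /= !big_andE.
Qed.

(* When all [E i] are odd, dichotomy allows at most one box of the suit to meet
   [setXn E] in an odd number of points, so the count equals its own parity,
   which is the parity of [#|setXn E :&: cover FF|]. *)
Lemma sum_prod_odd_meet E (FF : {set {set point X}}) : suit FF ->
  \sum_(A in FF) \prod_i odd_meet R (E i) (side A i) =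
  ([forall i, odd #|E i|] && odd #|setXn E :&: cover FF|)%:R.
Proof.
move=> FFs; have tI := trivIset_suit FFs; case: FFs => FFbox FFdich.
under eq_bigr => A AF do rewrite (prod_odd_meet _ (FFbox _ AF)).
rewrite -natr_sum; congr _%:R.
case: (boolP [forall i, _]) => [/forallP oddE|_] /=; last by rewrite big1.
have -> : odd #|setXn E :&: cover FF| =
          odd (\sum_(A in FF) odd #|setXn E :&: A|)%N.
  have cardI (C : {set point X}) : 
      #|setXn E :&: C| = (\sum_(p in C) (p \in setXn E))%N.
    rewrite -sum1_card big_mkcond [RHS]big_mkcond; apply: eq_bigr => p _.
    by rewrite in_setI; case: (p \in C); case: (p \in setXn E).
  rewrite cardI big_trivIset //= !(big_morph odd oddD (erefl _)).
  by apply: eq_bigr => A _; rewrite -cardI oddb.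
set n := (\sum_(A in FF) _)%N; suff : (n <= 1)%N by case: n => [|[]].
have [/existsP[A /andP[AF oddA]]|/existsPn none] :=
  boolP [exists A, (A \in FF) && odd #|setXn E :&: A|]; last first.
  rewrite /n big1 // => A AF; have := none A; rewrite AF /=.
  by move/negbTE->.
rewrite /n (bigD1 A) //= oddA big1 // => B /andP[BF /eqP BA].
apply/eqP; rewrite eqb0.
have [i eqi] := dichotomous_side (FFdich _ _ BF AF BA).
have sideodd C : C \in FF -> odd #|setXn E :&: C| -> odd #|E i :&: side C i|.
  move=> CF oddC; have := prod_odd_meet E (FFbox _ CF).
  rewrite oddC andbT (introT forallP oddE).
  rewrite /odd_meet (bigD1 i) //= oddE; case: odd => //=.
  by rewrite mul0r => /eqP; rewrite eq_sym oner_eq0.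
(* Otherwise the complementary sides would split the odd set [E i] into two odd parts. *)
apply/negP => /(sideodd _ BF); rewrite eqi -setDE => h.
have := oddE i; rewrite -(cardsID (side A i) (E i)) oddD h.
by rewrite (sideodd _ AF oddA).
Qed.

End Suits.

(** * From additive functions on boxes to equal sums over suits *)

Lemma additive_setXn (R : realType) (d : nat) (X : 'I_d -> finType)
    (f : {set point X} -> R) :
  box_additive f -> additive_from 0 (fun a => f (setXn a)).
Proof.
move=> fA a i B C _ nta ntB ntC.
have nt (D : {set X i}) : nontrivial D -> forall j, nontrivial (dfwith a D j).
  by move=> ntD j; case: dfwithP.
have bw (D : {set X i}) : nontrivial D -> box_with (setXn (dfwith a D)) (dfwith a D).
  by move=> /nt ntD; split=> //; apply: setXn_neq0 => j; case/andP: (ntD j).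
have pb (D : {set X i}) : nontrivial D -> proper_box (setXn (dfwith a D)).
  move=> ntD; exists (dfwith a D); split; first exact: bw.
  by move=> j; apply/eqP; case/andP: (nt _ ntD j).
have tw (D : {set X i}) : nontrivial D ->
    twin_pair (setXn (dfwith a D)) (setXn (dfwith a (~: D))).
  move=> ntD; exists (dfwith a D), (dfwith a (~: D)).
  split; [exact: bw|by apply: bw; rewrite nontrivialC|exists i].
  rewrite !dfwith_in setCK; split=> // j ji.
  by rewrite !dfwith_out // eq_sym.
(* The union of such a twin pair is the same for every [D], as [box_additive] requires. *)
have un (D : {set X i}) : setXn (dfwith a D) :|: setXn (dfwith a (~: D)) =
    setXn (dfwith a [set: X i]).
  apply/setP => p; rewrite (in_setI, in_setU); apply/orP/setXnP => [[]/setXnP pD j|pT].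
  - by have := pD j; have [<-|ij] := eqVneq i j;
      rewrite ?dfwith_in ?in_setT ?dfwith_out.
  - by have := pD j; have [<-|ij] := eqVneq i j;
      rewrite ?dfwith_in ?in_setT ?dfwith_out.
  have [pD|pD] := boolP (p i \in D); [left|right]; apply/setXnP => j;
    by have := pT j; have [<-|ij] := eqVneq i j;
      rewrite ?dfwith_in ?in_setC ?dfwith_out.
apply: fA; rewrite ?un //; try apply: pb; try apply: tw; rewrite ?nontrivialC //.
Qed.

Theorem theorem3p6 (R : realType) (d : nat) (X : 'I_d -> finType)
    (hX : forall i : 'I_d, (0 < #|X i|)%N)
    (F : {set point X}) (FF GG : {set {set point X}})
    (f : {set point X} -> R) :
  polybox F ->
  proper_suit FF -> suit_for FF F ->
  proper_suit GG -> suit_for GG F ->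
  box_additive f ->
  \sum_(A in FF) f A = \sum_(A in GG) f A.
Proof.
move=> _ [_ FFp] [FFs FFF] [_ GGp] [GGs GGF] fA.
have dep0 : depends_from 0 (fun a => f (setXn a)).
  by move=> a b ab; rewrite (eq_setXn (fun i => ab i isT)).
have nts A : A \in FF :|: GG -> forall i, nontrivial (side A i).
  by move=> /setUP[/FFp|/GGp] pA i; apply: proper_box_side.
have key (E : forall i, {set X i}) :
    \sum_(A in FF) \prod_i odd_meet R (E i) (side A i) =
    \sum_(A in GG) \prod_i odd_meet R (E i) (side A i).
  by rewrite !sum_prod_odd_meet // FFF GGF.
(* At [k = 0] the parity product is empty, so the choice of [E] is immaterial. *)
have := eq_sum_additive_from nts key (fun i => set0) (leq0n d) dep0
  (additive_setXn fA).
have drop (HH : {set {set point X}}) : suit HH ->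
    \sum_(A in HH) (\prod_(i < d | (i < 0)%N) odd_meet R set0 (side A i))
      * f (setXn (side A)) = \sum_(A in HH) f A.
  case=> HHbox _; apply: eq_bigr => A /HHbox /setXn_side ->.
  by rewrite big_pred0 // mul1r.
by rewrite !drop.
Qed.
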